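(* Let $\Phi=\{\phi_1,\dots,\phi_l\}$ be a finite collection of contracting similarities of $\mathbb{R}^n$ satisfying the open set condition, let $K\subset\mathbb{R}^n$ be the unique non-empty compact set with $K=\bigcup_{i=1}^l\phi_i(K)$, and let $d$ be the box counting dimension of $K$. Then $K$ satisfies the local scaling property with respect to $\kappa=\frac{d}{n}$; that is, there exist constants $c_3,c_4,r_1>0$ such that for any $0<r<r_1$, any $0<\delta<r$ and any $x\in K$, $$c_3\,\delta^{n-d}\,r^{d}\le\mathcal{H}^n(B(x,r)\cap\Delta(K,\delta))\le c_4\,\delta^{n-d}\,r^{d}.$$
   Context: A contracting similarity $\phi_i:\mathbb{R}^n\to\mathbb{R}^n$ is a map with $|\phi_i(x)-\phi_i(y)|=r_i|x-y|$ for all $x,y\in\mathbb{R}^n$, where $0<r_i<1$. $\Phi$ satisfies the open set condition if there exists a non-empty open set $O\subset\mathbb{R}^n$ such that $\phi_i(O)\subset O$ for each $1\le i\le l$ and $\phi_i(O)\cap\phi_j(O)=\emptyset$ whenever $i\ne j$. $\mathcal{H}^n$ is $n$-dimensional Hausdorff measure on $\mathbb{R}^n$ (a constant multiple of Lebesgue measure on Borel sets). For $F\subset\mathbb{R}^n$ and $\delta\ge0$, $\Delta(F,\delta):=\{x\in\mathbb{R}^n:d(x,F)<\delta\}$ (where $d(x,F)$ is the distance from $x$ to $F$). The box counting dimension of a bounded set $F$ is $n-\lim_{\delta\to0}\frac{\log\mathcal{H}^n(\Delta(F,\delta))}{\log\delta}$, when this limit exists (it does for $K$). A set $F\subset\mathbb{R}^n$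 satisfies the local scaling property with respect to $\kappa$ if there exist $c_3,c_4,r_1>0$ such that $c_3\delta^{n-\kappa n}r^{\kappa n}\le\mathcal{H}^n(B(x,r)\cap\Delta(F,\delta))\le c_4\delta^{n-\kappa n}r^{\kappa n}$ for all $0<r<r_1$, $\delta<r$ and $x\in F$. *)

(* Defs.v *)
From HB Require Import structures.
From mathcomp Require Import all_boot all_order all_algebra.
From mathcomp Require Import all_classical all_reals all_analysis.

Set Implicit Arguments.
Unset Strict Implicit.
Unset Printing Implicit Defensive.

Import Order.TTheory GRing.Theory Num.Theory.
Import numFieldNormedType.Exports.

Local Open Scope classical_set_scope.
Local Open Scope ring_scope.

(* R^n is 'rV[R]_n.  The library's norm on matrices is the sup norm, so the
   Euclidean metric is spelled out; both induce the library's topology on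
   'rV[R]_n, which is the one used below for "open" and "compact". *)
Definition l2norm (R : realType) (n : nat) (x : 'rV[R]_n) : R :=
  Num.sqrt (\sum_(i < n) x ord0 i ^+ 2).

Definition l2dist (R : realType) (n : nat) (x y : 'rV[R]_n) : R :=
  l2norm (x - y).

Definition l2ball (R : realType) (n : nat) (x : 'rV[R]_n) (r : R) :
    set 'rV[R]_n :=
  [set y | l2dist x y < r].

(* Extended-real valued, so that the distance to the empty set is +oo. *)
Definition setdist (R : realType) (n : nat) (x : 'rV[R]_n)
    (F : set 'rV[R]_n) : \bar R :=
  ereal_inf [set (l2dist x y)%:E | y in F].

(* The neighbourhood Delta(F, delta). *)
Definition nbhd (R : realType) (n : nat) (F : set 'rV[R]_n) (delta : R) :
    set 'rV[R]_n :=
  [set x | (setdist x F < delta%:E)%E].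

(* The maximum with 0 only matters for the empty set, whose diameter is 0. *)
Definition diam (R : realType) (n : nat) (U : set 'rV[R]_n) : \bar R :=
  maxe 0%E (ereal_sup [set (l2dist x y)%:E | x in U & y in U]).

Definition hausdorff_content (R : realType) (n : nat) (eps : R)
    (A : set 'rV[R]_n) : \bar R :=
  ereal_inf [set (\sum_(0 <= k <oo) diam (U k) ^+ n)%E |
    U in [set U : nat -> set 'rV[R]_n |
      A `<=` \bigcup_k U k /\ forall k, (diam (U k) <= eps%:E)%E]].

(* n-dimensional Hausdorff (outer) measure on R^n, for n > 0, without the
   normalizing factor that would make it equal to Lebesgue measure.  The
   contents increase as eps decreases to 0, so their limit is a supremum. *)
Definition hausdorff (R : realType) (n : nat) (A : set 'rV[R]_n) : \bar R :=
  ereal_sup [set hausdorff_content eps A | eps in [set eps : R | 0 < eps]].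

(* Meaningful for bounded F for which the limit exists. *)
Definition box_dim (R : realType) (n : nat) (F : set 'rV[R]_n) : R :=
  n%:R - lim (ln (fine (hausdorff (nbhd F delta))) / ln delta
                @[delta --> 0^'+]).

Definition contracting_similarity (R : realType) (n : nat)
    (f : 'rV[R]_n -> 'rV[R]_n) : Prop :=
  exists r : R, [/\ 0 < r, r < 1 &
    forall x y, l2dist (f x) (f y) = r * l2dist x y].

Definition open_set_condition (R : realType) (n l : nat)
    (phi : 'I_l -> 'rV[R]_n -> 'rV[R]_n) : Prop :=
  exists O : set 'rV[R]_n,
    [/\ open O, O !=set0,
        forall i, phi i @` O `<=` O &
        forall i j, i != j -> phi i @` O `&` phi j @` O = set0].

Definition local_scaling (R : realType) (n : nat) (F : set 'rV[R]_n)
    (kappa : R) : Prop :=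
  exists c3 c4 r1 : R, [/\ 0 < c3, 0 < c4, 0 < r1 &
    forall (r delta : R) (x : 'rV[R]_n),
      0 < r -> r < r1 -> 0 < delta -> delta < r -> F x ->
      ((c3 * (delta `^ (n%:R - kappa * n%:R)) * (r `^ (kappa * n%:R)))%:E
         <= hausdorff (l2ball x r `&` nbhd F delta))%E /\
      (hausdorff (l2ball x r `&` nbhd F delta)
         <= (c4 * (delta `^ (n%:R - kappa * n%:R))
               * (r `^ (kappa * n%:R)))%:E)%E].

(* Main.v *)
Require Import Defs.
From mathcomp Require Import all_boot all_order all_algebra.
From mathcomp Require Import all_classical all_reals all_analysis.
From mathcomp Require Import ring lra.

(** The similarity dimension [s] is the root of [\sum_i c_i ^ s = 1].  For each
scale [rho] the words whose ratio first drops below [rho] form a cut: their maps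
give a cover of [K] by copies of diameter comparable to [rho], the [s]-th powers of
their ratios sum to 1, so there are about [rho ^ - s] of them, and by the open set
condition the images of a fixed point of the open set are separated by a multiple
of [rho].  Hence only boundedly many pieces of scale [r] come close to a ball of
radius [r], and each of them splits into about [(r / delta) ^ s] pieces of scale
[delta], which are both covered by and (up to constants) separated like balls of
radius [delta].  The upper bound uses the cover, the lower bound the separated
points.  With [r] of order 1 these bounds also show that [s] is the box dimension.

No measurability is needed: covers by small cubes bound the Hausdorff measure of a
union of [N] balls of radius [rho] from above, and counting points of fine grids
bounds that of [N] disjoint balls from below, both by multiples of [N rho ^ n]. *)

Set Implicit Arguments.
Unset Strict Implicit.
Unset Printing Implicit Defensive.

Import Order.TTheory GRing.Theory Num.Theory.
Import numFieldNormedType.Exports.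

Local Open Scope classical_set_scope.
Local Open Scope ring_scope.

(** * Euclidean distance and similarities *)

Section Euclidean.
Context {R : realType} {n : nat}.
Implicit Types x y z : 'rV[R]_n.

Definition l2dot x y : R := \sum_(i < n) x ord0 i * y ord0 i.

Lemma l2dotC x y : l2dot x y = l2dot y x.
Proof. by apply: eq_bigr => i _; rewrite mulrC. Qed.

Lemma l2dotDl x y z : l2dot (x + y) z = l2dot x z + l2dot y z.
Proof. by rewrite -big_split; apply: eq_bigr => i _; rewrite mxE mulrDl. Qed.

Lemma l2dotNl x y : l2dot (- x) y = - l2dot x y.
Proof. by rewrite -sumrN; apply: eq_bigr => i _; rewrite mxE mulNr. Qed.

Lemma l2dotBl x y z : l2dot (x - y) z = l2dot x z - l2dot y z.
Proof. by rewrite l2dotDl l2dotNl. Qed.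

Lemma l2dotBr x y z : l2dot z (x - y) = l2dot z x - l2dot z y.
Proof. by rewrite l2dotC l2dotBl !(l2dotC z). Qed.

Lemma l2dotZl c x y : l2dot (c *: x) y = c * l2dot x y.
Proof. by rewrite mulr_sumr; apply: eq_bigr => i _; rewrite mxE mulrA. Qed.

Lemma l2dotZr c x y : l2dot x (c *: y) = c * l2dot x y.
Proof. by rewrite l2dotC l2dotZl l2dotC. Qed.

Lemma l2dot_ge0 x : 0 <= l2dot x x.
Proof. by apply: sumr_ge0 => i _; rewrite -expr2 sqr_ge0. Qed.

Lemma l2dot_eq0 x : l2dot x x = 0 -> x = 0.
Proof.
move=> /psumr_eq0P x0; apply/rowP => i; rewrite mxE.
by apply/eqP; rewrite -[_ == 0]orbb -mulf_eq0 x0// => j _; rewrite -expr2 sqr_ge0.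
Qed.

Lemma l2norm_ge0 x : 0 <= l2norm x.
Proof. exact: sqrtr_ge0. Qed.

Lemma sqr_l2norm x : l2norm x ^+ 2 = l2dot x x.
Proof.
rewrite sqr_sqrtr; last by apply: sumr_ge0 => i _; rewrite sqr_ge0.
by apply: eq_bigr => i _; rewrite expr2.
Qed.

(** Cauchy-Schwarz, from expanding the nonnegative square of [l2norm y *: x - l2norm x *: y].
    Vectors of norm zero are treated first because the factor [l2norm x * l2norm y] is cancelled at
    the end. *)
Lemma l2dot_le_l2norm x y : l2dot x y <= l2norm x * l2norm y.
Proof.
have [x0|x0] := eqVneq (l2norm x) 0.
  have /l2dot_eq0-> : l2dot x x = 0 by rewrite -sqr_l2norm x0 expr0n.
  rewrite -[X in l2dot X _](scale0r (0 : 'rV[R]_n)) l2dotZl mul0r.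
  by rewrite mulr_ge0 ?l2norm_ge0.
have [y0|y0] := eqVneq (l2norm y) 0.
  have /l2dot_eq0-> : l2dot y y = 0 by rewrite -sqr_l2norm y0 expr0n.
  rewrite -[X in l2dot _ X](scale0r (0 : 'rV[R]_n)) l2dotZr mul0r.
  by rewrite mulr_ge0 ?l2norm_ge0.
have xy0 : 0 < l2norm x * l2norm y by rewrite mulr_gt0 // lt_def l2norm_ge0 andbT.
have := l2dot_ge0 (l2norm y *: x - l2norm x *: y).
rewrite l2dotBl !l2dotBr !l2dotZl !l2dotZr -!sqr_l2norm (l2dotC y x).
set a := l2norm x in xy0 *; set b := l2norm y in xy0 *; set c := l2dot x y.
have -> : b * (b * a ^+ 2) - b * (a * c) - (a * (b * c) - a * (a * b ^+ 2)) =
  (a * b) * (2 * (a * b - c)) by ring.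
by rewrite pmulr_rge0 // pmulr_rge0 // subr_ge0.
Qed.

Lemma l2norm_add x y : l2norm (x + y) <= l2norm x + l2norm y.
Proof.
rewrite -(@ler_pXn2r _ 2) ?nnegrE ?addr_ge0 ?l2norm_ge0 //.
rewrite sqr_l2norm l2dotDl !(l2dotC _ (x + y)) !l2dotDl -!sqr_l2norm (l2dotC y x).
have := l2dot_le_l2norm x y; nra.
Qed.

Lemma l2normN x : l2norm (- x) = l2norm x.
Proof. by congr Num.sqrt; apply: eq_bigr => i _; rewrite mxE sqrrN. Qed.

Lemma l2dist_ge0 x y : 0 <= l2dist x y.
Proof. exact: l2norm_ge0. Qed.

Lemma l2distC x y : l2dist x y = l2dist y x.
Proof. by rewrite /l2dist -l2normN opprB. Qed.

Lemma l2dist_triangle x y z : l2dist x z <= l2dist x y + l2dist y z.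
Proof.
by have := l2norm_add (x - y) (y - z); rewrite addrA subrK.
Qed.

Lemma l2distxx x : l2dist x x = 0.
Proof.
rewrite /l2dist subrr /l2norm big1 ?sqrtr0 // => i _.
by rewrite mxE expr0n.
Qed.

Lemma l2dist_eq0 x y : l2dist x y = 0 -> x = y.
Proof.
move=> xy0; apply/subr0_eq/l2dot_eq0; rewrite -sqr_l2norm.
by rewrite -/(l2dist x y) xy0 expr0n.
Qed.

Lemma coord_le_l2dist x y i : `|x ord0 i - y ord0 i| <= l2dist x y.
Proof.
rewrite -sqrtr_sqr ler_wsqrtr // (bigD1 i) //= !mxE lerDl.
by apply: sumr_ge0 => j _; rewrite sqr_ge0.
Qed.

(* The crude constant n, instead of the square root of n, is enough here. *)
Lemma l2dist_le_coord x y (t : R) :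
  0 <= t -> (forall i, `|x ord0 i - y ord0 i| <= t) -> l2dist x y <= n%:R * t.
Proof.
move=> t0 xyt; rewrite -(@ler_pXn2r _ 2) ?nnegrE ?mulr_ge0 ?l2dist_ge0 //.
rewrite sqr_l2norm; apply: (@le_trans _ _ (\sum_(i < n) t ^+ 2)).
  apply: ler_sum => i _; rewrite -expr2 !mxE -[leLHS]real_normK ?num_real //.
  by rewrite lerXn2r ?nnegrE.
rewrite sumr_const card_ord -[leLHS]mulr_natl exprMn ler_wpM2r ?sqr_ge0 //.
by rewrite -natrX ler_nat; case: (n) => // m; rewrite leq_pmulr.
Qed.

(** Expresses inner products through distances alone, so that a similarity of ratio [c] multiplies
    inner products of differences by [c ^+ 2]. *)
Lemma l2dist_polarization x y z :
  2 * l2dot (x - z) (y - z) =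
  l2dist x z ^+ 2 + l2dist y z ^+ 2 - l2dist x y ^+ 2.
Proof.
rewrite !sqr_l2norm !(l2dotBl, l2dotBr) (l2dotC z x) (l2dotC z y) (l2dotC y x).
ring.
Qed.

End Euclidean.

Section Similarity.
Context {R : realType} {n : nat}.

Definition similarity (c : R) (f : 'rV[R]_n -> 'rV[R]_n) :=
  forall x y, l2dist (f x) (f y) = c * l2dist x y.


Lemma similarity_inj c f : 0 < c -> similarity c f -> injective f.
Proof.
move=> c0 sf x y fxy; apply: l2dist_eq0; move/eqP: (sf x y).
by rewrite fxy l2distxx eq_sym mulf_eq0 (gt_eqF c0) => /eqP.
Qed.

(* The images of the basis vectors, relative to [f 0], are the rows of a matrix
   M with [M *m M^T = c^2 I]; then [f (c^-2 (y - f 0) M^T) = y]. *)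
Lemma similarity_surj c f y : 0 < c -> similarity c f -> exists x, f x = y.
Proof.
move=> c0 sf.
have dotf a b : l2dot (f a - f 0) (f b - f 0) = c ^+ 2 * l2dot a b.
  apply: (@mulfI _ 2); first by rewrite pnatr_eq0.
  rewrite l2dist_polarization !sf !exprMn -!mulrDr -mulrBr.
  by rewrite -l2dist_polarization !subr0 mulrCA.
pose M := \matrix_(i < n) (f (delta_mx 0 i) - f 0).
have dotM (v : 'rV_n) i : (v *m M^T) ord0 i = l2dot v (f (delta_mx 0 i) - f 0).
  by rewrite mxE; apply: eq_bigr => j _; rewrite !mxE.
have MMT : M *m M^T = (c ^+ 2)%:M.
  apply/matrixP => i j.
  have -> : (M *m M^T) i j = (row i M *m M^T) ord0 j by rewrite -row_mul [RHS]mxE.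
  rewrite dotM rowK dotf !mxE /l2dot (bigD1 i) //= big1 ?addr0.
    by rewrite !mxE !eqxx mul1r mulr_natr eq_sym.
  by move=> k ki; rewrite !mxE (negbTE ki) andbF mul0r.
have MU : M^T \in unitmx.
  have : M *m M^T \in unitmx.
    by rewrite MMT unitmxE det_scalar unitrX // unitrX // unitfE gt_eqF.
  by rewrite unitmx_mul => /andP[].
pose x := (c ^+ 2)^-1 *: ((y - f 0) *m M^T).
(* [M^T] is invertible, so it is enough to compare inner products with the rows of [M]; for
   [f x - f 0] these are [c ^+ 2] times the coordinates of [x]. *)
exists x; apply: (addIr (- f 0)); apply: (can_inj (mulmxK MU)).
apply/rowP => i; rewrite dotM dotf.
rewrite {1}/l2dot (bigD1 i) //= big1 ?addr0 => [|k ki].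
  have -> : x ord0 i = (c ^+ 2)^-1 * ((y - f 0) *m M^T) ord0 i.
    by rewrite [LHS]mxE.
  rewrite [delta_mx _ _ _ _]mxE !eqxx mulr1 mulrA divff ?mul1r //.
  by rewrite expf_neq0 // gt_eqF.
by rewrite [delta_mx _ _ _ _]mxE (negbTE ki) andbF mulr0.
Qed.

End Similarity.

(** * Hausdorff measure of unions of balls *)

Section Diameter.
Context {R : realType} {n : nat}.
Implicit Types U : set 'rV[R]_n.

Lemma diam_ge0 U : (0 <= diam U)%E.
Proof. by rewrite le_max lexx. Qed.

Lemma diam_le U (c : R) : 0 <= c ->
  (forall x y, U x -> U y -> l2dist x y <= c) -> (diam U <= c%:E)%E.
Proof.
move=> c0 Uc; rewrite ge_max lee_fin c0 /=.
by apply/ereal_supP => _ [x Ux [y Uy <-]]; rewrite lee_fin Uc.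
Qed.

Lemma l2dist_le_diam U x y : U x -> U y -> ((l2dist x y)%:E <= diam U)%E.
Proof.
move=> Ux Uy; rewrite le_max; apply/orP; right.
by apply: ereal_sup_ubound; exists x => //; exists y.
Qed.

End Diameter.

Lemma le_hausdorff {R : realType} {n : nat} (A D : set 'rV[R]_n) :
  A `<=` D -> (hausdorff A <= hausdorff D)%E.
Proof.
move=> AD; apply/ereal_supP => _ [eps eps0 <-].
apply: (@le_trans _ _ (hausdorff_content eps D)).
  apply/ereal_infP => _ [U [DU Ueps] <-]; apply: ereal_inf_lbound.
  by exists U => //; split=> // x /AD/DU.
by apply: ereal_sup_ubound; exists eps.
Qed.

(** * Upper bounds for Hausdorff measure from finite covers *)

Section HausdorffUpper.
Context {R : realType} {n : nat}.
Hypothesis n_gt0 : (0 < n)%N.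
Implicit Types A : set 'rV[R]_n.

Lemma hausdorff_content_le (T : finType) (V : T -> set 'rV[R]_n) (eps c : R) A :
  0 <= c -> c <= eps -> (forall t, (diam (V t) <= c%:E)%E) ->
  A `<=` \bigcup_t V t ->
  (hausdorff_content eps A <= (#|T|%:R * c ^+ n)%:E)%E.
Proof.
move=> c0 ceps Vc AV.
(* The finite family is padded with empty sets, of diameter 0; as [n] is positive, the tail of the
   series vanishes. *)
pose U (k : nat) : set 'rV[R]_n :=
  if insub k is Some i then V (@enum_val T predT i) else set0.
have Uc k : (diam (U k) <= c%:E)%E.
  by rewrite /U; case: insubP => [i _ _|_]; [exact: Vc | exact: diam_le].
apply: (@le_trans _ _ (\sum_(0 <= k <oo) diam (U k) ^+ n)%E).
  apply: ereal_inf_lbound; exists U => //; split=> [x /AV[t _ Vx]|k].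
    exists (enum_rank t) => //; rewrite /U insubT ?ltn_ord // => lt_t.
    rewrite (_ : Sub _ _ = enum_rank t) ?enum_rankK //; exact: val_inj.
  by rewrite (le_trans (Uc k)) ?lee_fin.
rewrite (nneseries_split 0 #|T|); last by move=> k _; rewrite expe_ge0 ?diam_ge0.
rewrite add0n [X in (_ + X)%E]eseries0 ?adde0; last first.
  move=> k Tk _; rewrite /U insubF; last by rewrite ltnNge Tk.
  rewrite (_ : diam _ = 0)%E; first by rewrite -EFin_expe expr0n gtn_eqF.
  by apply/eqP; rewrite eq_le diam_ge0 andbT; apply: diam_le.
apply: (@le_trans _ _ (\sum_(0 <= k < #|T|) (c ^+ n)%:E)%E).
  apply: lee_sum => k _; have := Uc k; have := diam_ge0 (U k).
  case: (diam (U k)) => [d| |] //; rewrite !lee_fin -EFin_expe lee_fin => d0 dc.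
  by rewrite lerXn2r ?nnegrE.
by rewrite sumEFin lee_fin sumr_const_nat subn0 mulr_natl.
Qed.

(* Cutting the cube of side [2 rho] around each centre into [m ^ n] cells, with m
   large, gives covers of arbitrarily small mesh and of the same cost. *)
Lemma hausdorff_le_balls (s : seq 'rV[R]_n) (rho : R) A : 0 < rho ->
  (forall y, A y -> exists2 z, z \in s & l2dist y z < rho) ->
  (hausdorff A <= ((size s)%:R * (2 * n%:R * rho) ^+ n)%:E)%E.
Proof.
move=> rho0 As; apply/ereal_supP => _ [eps /= eps0 <-].
have nR0 : 0 < n%:R :> R by rewrite ltr0n.
(* Chosen so that cells of side [h = 2 rho / (m + 1)] have diameter at most [n * h <= eps]. *)
pose m := Num.truncn (2 * n%:R * rho / eps).
have m0 : 0 < m.+1%:R :> R by rewrite ltr0n.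
pose h := 2 * rho / m.+1%:R.
have h0 : 0 < h by rewrite divr_gt0 ?mulr_gt0.
pose T : finType := ('I_(size s) * {ffun 'I_n -> 'I_m.+1})%type.
pose V (t : T) := [set y : 'rV[R]_n | forall j,
  h * (t.2 j)%:R <= y ord0 j - (nth 0 s t.1) ord0 j + rho <= h * (t.2 j)%:R + h].
(* The [(m + 1) ^ n] cells per cube compensate exactly for the factor [(m + 1) ^ - n] in their cost,
   so the bound does not depend on [eps]. *)
have -> : (size s)%:R * (2 * n%:R * rho) ^+ n = #|T|%:R * (n%:R * h) ^+ n.
  rewrite card_prod card_ffun !card_ord natrM natrX -[RHS]mulrA -exprMn /h.
  by congr (_ * _ ^+ _); field; rewrite gt_eqF.
apply: (@hausdorff_content_le _ V).
- by rewrite mulr_ge0 // ltW.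
- have := truncnS_gt (2 * n%:R * rho / eps); rewrite -/m ltr_pdivrMr // => mh.
  rewrite /h mulrA ler_pdivrMr //; lra.
- move=> t; apply: diam_le => [|x y Vx Vy]; first by rewrite mulr_ge0 // ltW.
  apply: l2dist_le_coord => [|j]; first exact: ltW.
  rewrite ler_norml; have /andP[] := Vx j; have /andP[] := Vy j; lra.
- move=> y /As[z zs yz].
  pose x j := (y ord0 j - z ord0 j + rho) / h.
  have xm j : 0 <= x j < m.+1%:R.
    have := le_lt_trans (coord_le_l2dist y z j) yz; rewrite ltr_norml => /andP[y1 y2].
    apply/andP; split; first by rewrite divr_ge0 // ?(ltW h0) //; lra.
    by rewrite ltr_pdivrMr // /h mulrCA divff ?gt_eqF // mulr1; lra.
  have lt_z : (index z s < size s)%N by rewrite index_mem.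
  exists (Ordinal lt_z, [ffun j => inord (Num.truncn (x j))]) => // j /=.
  have /andP[x0 x1] := xm j.
  rewrite nth_index // ffunE inordK; last by rewrite truncn_lt_nat.
  have /andP[] := truncn_itv x0.
  rewrite /x ler_pdivlMr // ltr_pdivrMr // mulrC => -> /ltW.
  by rewrite -natr1 mulrDl mul1r (mulrC _ h) => ->.
Qed.

End HausdorffUpper.

(** * Lower bounds for Hausdorff measure from packings *)

Section HausdorffLower.
Context {R : realType} {n : nat}.
Hypothesis n_gt0 : (0 < n)%N.
Implicit Types A : set 'rV[R]_n.

Definition cube (p : 'rV[R]_n) (t : R) :=
  [set y : 'rV[R]_n | forall j, `|y ord0 j - p ord0 j| < t].

Lemma open_cube p t : open (cube p t).
Proof.
have [t0|t0] := ltP 0 t; last first.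
  (* Since [n] is positive there is a coordinate, and its constraint cannot hold for [t <= 0]. *)
  rewrite (_ : cube p t = set0) ?openE //; last first.
    rewrite -subset0 => y /(_ (Ordinal n_gt0)).
    by rewrite ltNge (le_trans t0) ?normr_ge0.
rewrite (_ : cube p t = ball p t); first exact: ball_open.
apply/seteqP; split=> y.
  move=> yp; split=> // i j; rewrite ord1 /ball /= distrC; exact: yp.
by move=> [_ yp] j; have := yp ord0 j; rewrite /ball /= distrC.
Qed.

Definition closed_cube (p : 'rV[R]_n) (t : R) :=
  [set y : 'rV[R]_n | forall j, `|y ord0 j - p ord0 j| <= t].

Lemma compact_closed_cube p t : compact (closed_cube p t).
Proof.
rewrite (_ : closed_cube p t =
  [set y | forall j, `[p ord0 j - t, p ord0 j + t]%classic (y ord0 j)]).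
  by apply: (@rV_compact R n (fun j => `[p ord0 j - t, p ord0 j + t]%classic)) => j;
    exact: segment_compact.
by apply/seteqP; split=> y yp j; have := yp j; rewrite /= in_itv /= ler_distl.
Qed.

(** Pigeonhole: cut the cube into cells of side [h]. Two points in one cell differ by less than [h]
    in every coordinate, so each cell holds at most one point. *)
Lemma card_separated_le (I : finType) (y : I -> 'rV[R]_n) p (t h : R)
    (P : pred I) : 0 < h -> 0 <= t ->
  {in P &, forall a b, a != b -> exists j, h <= `|y a ord0 j - y b ord0 j|} ->
  (forall a, P a -> cube p t (y a)) ->
  #|P|%:R <= (2 * t / h + 1) ^+ n.
Proof.
move=> h0 t0 sepy yP.
have q0 : 0 <= 2 * t / h by rewrite divr_ge0 ?mulr_ge0 // ltW.
pose m := Num.truncn (2 * t / h).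
pose x a j := (y a ord0 j - (p ord0 j - t)) / h.
have x0 a j : P a -> 0 <= x a j.
  move=> /yP/(_ j); rewrite ltr_distl => /andP[y1 y2].
  by rewrite divr_ge0 ?(ltW h0) //; lra.
have xm a j : P a -> (Num.truncn (x a j) < m.+1)%N.
  move=> Pa; have := yP _ Pa j; rewrite ltr_distl => /andP[y1 y2].
  rewrite ltnS le_truncn // ler_wpM2r ?invr_ge0 ?(ltW h0) //; lra.
pose c a : {ffun 'I_n -> 'I_m.+1} := [ffun j => inord (Num.truncn (x a j))].
have cinj : {in P &, injective c}.
  move=> a b Pa Pb cab; apply/eqP/negPn/negP => /(sepy _ _ Pa Pb)[j].
  have := congr1 (fun g : {ffun 'I_n -> 'I_m.+1} => val (g j)) cab.
  rewrite !ffunE /= !inordK ?xm // => xab.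
  have /andP[] := truncn_itv (x0 a j Pa); have /andP[] := truncn_itv (x0 b j Pb).
  rewrite xab -natr1; set k := _%:R.
  rewrite /x !ler_pdivlMr // !ltr_pdivrMr // !mulrDl mul1r => b1 b2 a1 a2.
  by rewrite leNgt ltr_norml => /negP; apply; apply/andP; split; lra.
have := leq_card_in _ _ cinj; rewrite card_ffun !card_ord -(ler_nat R) => /le_trans.
apply; rewrite natrX lerXn2r ?nnegrE ?addr_ge0 //.
by rewrite -natr1 lerD2r truncn_le.
Qed.

(* Volume comparison without a measure: count the points of fine grids, one in
   each cube of the packing; the different grids need not be aligned. *)
Lemma packing_le_covering (N M : nat) (z : 'I_N -> 'rV[R]_n)
    (p : nat -> 'rV[R]_n) (t : nat -> R) (tau : R) : 0 < tau ->
  (forall k, 0 <= t k) ->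
  (forall a b, a != b -> exists j, 4 * tau <= `|z a ord0 j - z b ord0 j|) ->
  (forall a y, closed_cube (z a) tau y -> exists2 k, (k < M)%N & cube (p k) (t k) y) ->
  N%:R * tau ^+ n <= \sum_(k < M) t k ^+ n.
Proof.
move=> tau0 t0 sepz cov.
(* Each packing cube receives a grid of [(m + 1) ^ n] points of mesh [h]; the boundary error
   [tau / (m + 1)] disappears as [m] grows. *)
have step m : N%:R * tau ^+ n <= \sum_(k < M) (t k + tau * m.+1%:R^-1) ^+ n.
  have m0 : 0 < m.+1%:R :> R by rewrite ltr0n.
  pose h := 2 * tau / m.+1%:R.
  have h0 : 0 < h by rewrite divr_gt0 ?mulr_gt0.
  have hm : h * m.+1%:R = 2 * tau by rewrite divfK // gt_eqF.
  pose I : finType := ('I_N * {ffun 'I_n -> 'I_m.+1})%type.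
  pose y (a : I) : 'rV[R]_n := \row_j (z a.1 ord0 j - tau + h * (a.2 j)%:R).
  have ycube a : closed_cube (z a.1) tau (y a).
    move=> j; rewrite mxE ler_distl.
    have : h * (a.2 j)%:R <= 2 * tau.
      by rewrite -hm ler_wpM2l ?(ltW h0) // ler_nat ltnW.
    have : 0 <= h * (a.2 j)%:R by rewrite mulr_ge0 // ltW.
    move=> *; apply/andP; split; lra.
  have h2 : h <= 2 * tau by rewrite -hm ler_peMr ?(ltW h0) // ler1n.
  have sepy a b : a != b -> exists j, h <= `|y a ord0 j - y b ord0 j|.
    (* Points of different cubes differ by at least [4 tau - 2 tau >= h] in some coordinate; points
       of one grid differ by a nonzero multiple of [h]. *)
    move=> ab; have [ab1|/sepz[j zab]] := eqVneq a.1 b.1; last first.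
      exists j; have := ycube a j; have := ycube b j; rewrite !ler_norml.
      move=> /andP[b1 b2] /andP[a1 a2]; move: zab; rewrite !ler_normr.
      by move=> /orP[] zab; apply/orP; [left|right]; lra.
    have [j ab2] : exists j, a.2 j != b.2 j.
      apply/existsP; apply: contraNT ab; rewrite negb_exists => /forallP ab.
      rewrite [a]surjective_pairing [b]surjective_pairing ab1 xpair_eqE eqxx /=.
      by apply/eqP/ffunP => j; apply/eqP; have := ab j; rewrite negbK.
    exists j; rewrite !mxE ab1.
    rewrite (_ : _ - _ = h * ((a.2 j)%:R - (b.2 j)%:R)); last by ring.
    rewrite normrM gtr0_norm // ler_peMr ?(ltW h0) //.
    rewrite ler_normr; move: ab2; rewrite -val_eqE neq_ltn.
    move=> /orP[] lt_ab; apply/orP; [right|left]; rewrite ?opprB lerBrDr.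
      by rewrite addrC natr1 ler_nat.
    by rewrite addrC natr1 ler_nat.
  pose P k := [pred a | `[< cube (p k) (t k) (y a) >]].
  have PI : (#|I| <= \sum_(k < M) #|P k|)%N.
    rewrite -sum1_card (eq_bigr (fun k : 'I_M => \sum_(a in I) (P k a : nat))%N).
      rewrite exchange_big /=; apply: leq_sum => a _.
      have [k kM ka] := cov _ _ (ycube a).
      by rewrite (bigD1 (Ordinal kM)) //= asboolT.
    by move=> k _; rewrite -sum1_card big_mkcond /=.
  have Pk k : #|P k|%:R <= (2 * t k / h + 1) ^+ n.
    by apply: (@card_separated_le _ y (p k)) => // [a b _ _|a /asboolP]; auto.
  have := PI; rewrite card_prod card_ffun !card_ord -(ler_nat R) natr_sum natrM natrX.
  move=> /le_trans /(_ (ler_sum _ (fun k _ => Pk (val k)))).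
  (* Multiplying by [(tau / (m + 1)) ^ n] turns the number of points into [N tau ^ n] and each
     [2 t k / h + 1] into [t k + tau / (m + 1)]. *)
  rewrite -(ler_pM2r (exprn_gt0 n (_ : 0 < tau / m.+1%:R))) ?divr_gt0 //.
  rewrite -mulrA -exprMn mulrCA divff ?gt_eqF // mulr1 => /le_trans; apply.
  rewrite mulr_suml ler_sum // => k _; rewrite -exprMn le_eqVlt; apply/orP; left.
  by apply/eqP; congr (_ ^+ _); rewrite /h; field; rewrite !gt_eqF.
(* The right-hand side of [step] is a polynomial in [1 / (m + 1)], so its limit is the value at
   0. *)
pose q := \sum_(k < M) ((t k)%:P + tau *: 'X) ^+ n.
have qE x : q.[x] = \sum_(k < M) (t k + tau * x) ^+ n.
  by rewrite horner_sum; apply: eq_bigr => k _; rewrite horner_exp !hornerE.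
have q0 : q.[harmonic m] @[m --> \oo] --> q.[0].
  apply: continuous_cvg; [exact: continuous_horner | exact: cvg_harmonic].
rewrite (_ : \sum_(k < M) _ = lim (q.[harmonic m] @[m --> \oo])).
  apply: limr_ge; first by apply/cvg_ex; exists q.[0].
  by near=> m; rewrite qE; exact: step.
rewrite (cvg_lim _ q0) // qE; apply: eq_bigr => k _.
by rewrite mulr0 addr0.
Unshelve. all: by end_near. Qed.

(** Lets a covering set of diameter [d], possibly 0, be enlarged to an open cube at arbitrarily
    small extra cost. *)
Lemma exprn_approx (d e : R) : 0 <= d -> 0 < e ->
  exists2 t, d < t & t ^+ n <= d ^+ n + e.
Proof.
move=> d0 e0; pose q : {poly R} := (d%:P + 'X) ^+ n.
have qE x : q.[x] = (d + x) ^+ n by rewrite horner_exp !hornerE.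
have q0 : q.[harmonic m] @[m --> \oo] --> q.[0].
  apply: continuous_cvg; [exact: continuous_horner | exact: cvg_harmonic].
have /cvgr_le/(_ (d ^+ n + e)) := q0.
rewrite qE addr0 ltrDl => /(_ e0)[m _ /(_ m (leqnn m))] /=; rewrite qE => qm.
by exists (d + harmonic m) => //; rewrite ltrDl harmonic_gt0.
Qed.

(** Any countable cover is enlarged to open cubes at total extra cost [e]. Compactness of cubes
    inside the balls leaves finitely many of them, and the packing comparison applies. *)
Lemma balls_le_hausdorff (N : nat) (z : 'I_N -> 'rV[R]_n) (rho : R) A :
  0 < rho ->
  (forall a b, a != b -> 2 * rho <= l2dist (z a) (z b)) ->
  (forall a y, l2dist y (z a) < rho -> A y) ->
  ((N%:R * (rho / (4 * n%:R)) ^+ n)%:E <= hausdorff A)%E.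
Proof.
move=> rho0 sepz zA.
have nR0 : 0 < n%:R :> R by rewrite ltr0n.
(* With [tau = rho / (4 n)], the cube of half-side [tau] lies in the ball of radius [rho], and
   centres at distance [2 rho] are [4 tau] apart in some coordinate. *)
set tau := rho / _.
have tau0 : 0 < tau by rewrite divr_gt0 ?mulr_gt0.
have ntau : n%:R * tau * 4 = rho.
  by rewrite /tau; field; rewrite gt_eqF.
(* One scale suffices for a lower bound on the supremum; scale 1 makes all diameters finite. *)
apply: (@le_trans _ _ (hausdorff_content 1 A)); last first.
  by apply: ereal_sup_ubound; exists 1 => //=.
apply/ereal_infP => _ [U [AU U1] <-].
have dU k : diam (U k) = (fine (diam (U k)))%:E.
  rewrite fineK // ge0_fin_numE ?diam_ge0 //.
  by rewrite (le_lt_trans (U1 k)) // ltry.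
pose d k := fine (diam (U k)).
have d0 k : 0 <= d k by rewrite -lee_fin -dU diam_ge0.
apply/lee_addgt0Pr => e e0.
have tex k : exists t, d k < t /\ t ^+ n <= d k ^+ n + e / (2 ^ k.+1)%:R.
  have [||t dt te] := @exprn_approx (d k) (e / (2 ^ k.+1)%:R) => //.
    by rewrite divr_gt0 // ltr0n expn_gt0.
  by exists t.
have [t tP] := choice tex.
(* A point of [U k]; the default 0 is harmless, since an empty [U k] lies in any cube. *)
pose p k := xget 0 (U k).
have Ucube k y : U k y -> cube (p k) (t k) y.
  move=> Uy j; apply: le_lt_trans (coord_le_l2dist _ _ _) _.
  apply: le_lt_trans (proj1 (tP k)).
  by rewrite -lee_fin -dU; apply: l2dist_le_diam => //; exact: xgetI Uy.
have covM a : exists M, forall y, closed_cube (z a) tau y ->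
    exists2 k, (k < M)%N & cube (p k) (t k) y.
  have := @compact_closed_cube (z a) tau.
  rewrite compact_cover => /(_ nat [set: nat] (fun k => cube (p k) (t k))).
  case=> [k _|y ya|D _ Dcov].
  - exact: open_cube.
  - have /AU[k _ Uy] : A y.
      apply: (zA a); apply: le_lt_trans (l2dist_le_coord (ltW tau0) ya) _.
      have := mulr_gt0 nR0 tau0; lra.
    by exists k => //; exact: Ucube.
  - exists (\max_(k <- finmap.enum_fset D) k).+1 => y /Dcov[k /= kD ky]; exists k => //.
    by rewrite ltnS; exact: leq_bigmax_seq.
have [M MP] := choice covM.
have MN a y : closed_cube (z a) tau y ->
    exists2 k, (k < \max_b M b)%N & cube (p k) (t k) y.
  by move=> /MP[k kM ky]; exists k => //; apply: leq_trans kM (leq_bigmax _).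
have := packing_le_covering tau0 (fun k => le_trans (d0 k) (ltW (proj1 (tP k)))) _ MN.
rewrite -lee_fin => /(_ _)/le_trans; apply.
  move=> a b /sepz sepab; apply/existsP; move: sepab; apply: contraTT.
  rewrite negb_exists => /forallP ab; rewrite -ltNge.
  have : l2dist (z a) (z b) <= n%:R * (4 * tau).
    by apply: l2dist_le_coord => [|j]; [lra | rewrite ltW // ltNge ab].
  lra.
apply: (@le_trans _ _ (\sum_(0 <= k <oo) (diam (U k) ^+ n + (e / (2 ^ k.+1)%:R)%:E))%E);
  last by apply: epsilon_trick => [k|]; rewrite ?expe_ge0 ?diam_ge0 // ltW.
have e2 k : 0 <= e / (2 ^ k.+1)%:R by rewrite divr_ge0 // ltW.
apply: le_trans (@nneseries_lim_ge _ _ xpredT 0 (\max_b M b) _); last first.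
  by move=> k _ _; rewrite adde_ge0 ?expe_ge0 ?diam_ge0 // lee_fin.
rewrite -sumEFin big_mkord; apply: lee_sum => k _.
by rewrite dU -EFin_expe -EFinD lee_fin; exact: (proj2 (tP k)).
Qed.

End HausdorffLower.

(** * Cuts of the word tree *)

Section Words.
Context {R : realType} {n l : nat}.
Variables (phi : 'I_l -> 'rV[R]_n -> 'rV[R]_n) (c : 'I_l -> R).
Implicit Types w u v : seq 'I_l.

Definition word_map w := foldr (fun i g => phi i \o g) id w.

Definition word_ratio w := \prod_(i <- w) c i.

(* The words whose ratio first drops to [rho] or below, provided that the fuel
   [m] is large enough. *)
Fixpoint cut (m : nat) (rho : R) : seq (seq 'I_l) :=
  if 1 <= rho then [:: [::]] else
  if m is m'.+1 then [seq i :: w | i <- enum 'I_l, w <- cut m' (rho / c i)]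
  else [:: [::]].

Lemma cut_ge1 m rho : 1 <= rho -> cut m rho = [:: [::]].
Proof. by case: m => [|m] rho1 /=; rewrite rho1. Qed.

Hypothesis c_gt0 : forall i, 0 < c i.

Lemma word_ratio_gt0 w : 0 < word_ratio w.
Proof. by rewrite prodr_gt0. Qed.

Lemma word_ratio_cons i w : word_ratio (i :: w) = c i * word_ratio w.
Proof. exact: big_cons. Qed.

Lemma uniq_cut m rho : uniq (cut m rho).
Proof.
elim: m rho => [|m IH] rho /=; case: ifP => // _.
apply: allpairs_uniq_dep => [|i _|]; rewrite ?enum_uniq //.
by move=> [i w] [j v] _ _ /= [-> ->].
Qed.

(** Splitting a word into its one-letter extensions preserves the total weight, wherever the
    recursion stops. *)
Lemma sum_cut s m rho : \sum_i c i `^ s = 1 ->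
  \sum_(w <- cut m rho) word_ratio w `^ s = 1.
Proof.
move=> cs; have r0 : word_ratio [::] `^ s = 1.
  by rewrite /word_ratio big_nil powR1.
elim: m rho => [|m IH] rho /=; case: ifP => _; rewrite ?big_seq1 //.
rewrite big_allpairs_dep big_enum /= -[RHS]cs; apply: eq_bigr => i _.
rewrite -[RHS]mulr1 -(IH (rho / c i)) mulr_sumr; apply: eq_bigr => w _.
by rewrite word_ratio_cons powRM // ltW // word_ratio_gt0.
Qed.

(** A word is extended only while its ratio exceeds [rho], and the last letter costs at most a
    factor [b]. Running out of fuel only makes the ratio larger. *)
Lemma cut_ratio_ge b m rho w : b <= 1 -> (forall i, b <= c i) -> 0 < rho ->
  rho <= 1 -> w \in cut m rho -> b * rho <= word_ratio w.
Proof.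
move=> b1 bc.
have nil x : 0 < x -> x <= 1 -> b * x <= word_ratio [::].
  move=> x0 x1; rewrite /word_ratio big_nil.
  by rewrite (le_trans (ler_wpM2r (ltW x0) b1)) ?mul1r.
elim: m rho w => [|m IH] rho w rho0 rho1 /=.
  by case: ifP => _; rewrite inE => /eqP->; exact: nil.
case: ifP => [_|_ /allpairsPdep[i [v [_ vi ->]]]].
  by rewrite inE => /eqP->; exact: nil.
rewrite word_ratio_cons; have [ci|ci] := leP rho (c i).
  rewrite -ler_pdivrMl // mulrCA (mulrC _ rho); apply: (IH _ _ _ _ vi).
    by rewrite divr_gt0.
  by rewrite ler_pdivrMr // mul1r.
move: vi; rewrite cut_ge1; last by rewrite ler_pdivlMr // mul1r ltW.
rewrite inE => /eqP->; rewrite /word_ratio big_nil mulr1.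
have [b0|b0] := leP 0 b; first by rewrite (le_trans _ (bc i)) // ler_piMr.
by rewrite ltW // (le_lt_trans _ (c_gt0 i)) // ltW // nmulr_rlt0.
Qed.

(** [B ^+ m <= rho] says that the fuel suffices: every letter multiplies the ratio by at most
    [B]. *)
Lemma cut_ratio_le B m rho w : (forall i, c i <= B) -> 0 < B ->
  B ^+ m <= rho -> w \in cut m rho -> word_ratio w <= rho.
Proof.
move=> cB B0; elim: m rho w => [|m IH] rho w Bm.
  rewrite cut_ge1 // inE => /eqP->.
  by rewrite /word_ratio big_nil.
rewrite /=; case: ifP => [rho1|_ /allpairsPdep[i [v [_ vi ->]]]].
  by rewrite inE => /eqP->; rewrite /word_ratio big_nil.
rewrite word_ratio_cons -ler_pdivlMl // mulrC; apply: IH vi.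
rewrite ler_pdivlMr // (le_trans _ Bm) // exprSr ler_wpM2l //.
by rewrite exprn_ge0 // ltW.
Qed.

Hypothesis phi_sim : forall i, similarity (c i) (phi i).

Lemma word_map_similarity w : similarity (word_ratio w) (word_map w).
Proof.
elim: w => [|i w IH] x y /=; first by rewrite /word_ratio big_nil mul1r.
by rewrite phi_sim IH word_ratio_cons mulrA.
Qed.

Section InvariantSet.
Variable K : set 'rV[R]_n.
Hypothesis K_inv : K = \bigcup_(i in [set: 'I_l]) (phi i @` K).

Lemma word_map_inv w x : K x -> K (word_map w x).
Proof.
elim: w => //= i w IH Kx; rewrite K_inv; exists i => //.
by exists (word_map w x) => //; exact: IH.
Qed.

Lemma cut_cover m rho x : K x ->
  exists2 w, w \in cut m rho & exists2 y, K y & x = word_map w y.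
Proof.
have nil y : K y -> exists2 w, w \in [:: [::]] & exists2 z, K z & y = word_map w z.
  by move=> Ky; exists [::]; [rewrite inE | exists y].
elim: m rho x => [|m IH] rho x Kx /=; case: ifP => _; try exact: nil.
move: Kx; rewrite {1}K_inv => -[i _ [y Ky <-]].
have [w wcut [z Kz ->]] := IH (rho / c i) y Ky.
exists (i :: w); last by exists z.
by apply/allpairsPdep; exists i, w; split; rewrite ?mem_enum.
Qed.

End InvariantSet.

Section OpenSet.
Variable O : set 'rV[R]_n.
Hypothesis O_inv : forall i, phi i @` O `<=` O.
Hypothesis O_disj : forall i j, i != j -> phi i @` O `&` phi j @` O = set0.

Lemma word_map_open w x : O x -> O (word_map w x).
Proof.
by elim: w => //= i w IH Ox; apply: (O_inv (i := i)); exists (word_map w x); auto.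
Qed.

(** Common first letters cancel by injectivity; at the first difference the two points lie in the
    disjoint images of [O]. Neither word is a proper prefix of the other, as both end at leaves of
    the same tree. *)
Lemma cut_disjoint m rho u v x y : u \in cut m rho -> v \in cut m rho ->
  O x -> O y -> word_map u x = word_map v y -> u = v.
Proof.
elim: m rho u v => [|m IH] rho u v /=.
  by case: ifP => _; rewrite !inE => /eqP-> /eqP->.
case: ifP => [_|_]; first by rewrite !inE => /eqP-> /eqP->.
move=> /allpairsPdep[i [u' [_ ui ->]]] /allpairsPdep[j [v' [_ vj ->]]] Ox Oy /=.
have [eq_ij|ij] := eqVneq i j.
  rewrite -{j}eq_ij in vj *.
  move=> /(similarity_inj (c_gt0 i) (@phi_sim i)) uv.
  by rewrite (IH _ _ _ ui vj Ox Oy uv).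
move=> uv; exfalso; have := O_disj ij; rewrite -subset0.
move=> /(_ (phi i (word_map u' x))); apply; split.
  by exists (word_map u' x) => //; exact: word_map_open.
by rewrite uv; exists (word_map v' y) => //; exact: word_map_open.
Qed.

(* [word_map u] maps the ball of radius [a] onto a full ball, since a similarity
   is surjective. *)
Lemma cut_separated m rho u v o a : l2ball o a `<=` O -> 0 < a ->
  u \in cut m rho -> v \in cut m rho -> u != v ->
  a * word_ratio u <= l2dist (word_map u o) (word_map v o).
Proof.
move=> aO a0 uc vc; apply: contraNT; rewrite -ltNge => uv.
have [x xv] := similarity_surj (word_map v o) (word_ratio_gt0 u)
  (@word_map_similarity u).
apply/eqP; apply: (cut_disjoint uc vc _ _ xv); apply: aO.
  by move: uv; rewrite -xv word_map_similarity mulrC ltr_pM2r ?word_ratio_gt0.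
by rewrite /l2ball /= l2distxx.
Qed.

End OpenSet.

End Words.

(** * The similarity dimension *)

Lemma finite_uniform_bounds {R : realType} (l : nat) (c : 'I_l -> R) :
  (forall i, 0 < c i) -> (forall i, c i < 1) ->
  exists b B : R, [/\ 0 < b, b <= 1, 0 < B & B < 1] /\
    (forall i, b <= c i <= B).
Proof.
move=> c0 c1.
(* The initial values 1 and 1/2 give [b <= 1] and [0 < B] even for an empty family. *)
exists (\big[Num.min/1]_i c i), (\big[Num.max/2^-1]_i c i); split; first split.
- by apply: lt_bigmin.
- exact: bigmin_le_id.
- by apply: (lt_le_trans _ (bigmax_ge_id _ _ _ _)); rewrite invr_gt0.
- by apply: bigmax_lt => //; rewrite invf_lt1 // ltr1n.
- by move=> i; rewrite bigmin_le_cond ?le_bigmax_cond.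
Qed.

Lemma similarity_dimension {R : realType} (l : nat) (c : 'I_l -> R) :
  (0 < l)%N -> (forall i, 0 < c i) -> (forall i, c i < 1) ->
  exists2 s, 0 <= s & \sum_i c i `^ s = 1.
Proof.
move=> l0 c0 c1.
have [b [B [[b0 b1 B0 B1] bcB]]] := finite_uniform_bounds c0 c1.
have lR1 : 1 <= l%:R :> R by rewrite ler1n.
have lnB : 0 < - ln B by rewrite oppr_gt0 ln_lt0 ?B0.
(* This solves [l * B ^ t = 1], so the sum is at most 1 at [t], while at 0 it equals [l >= 1]; the
   intermediate value theorem gives the root. *)
pose t := ln l%:R / - ln B.
have t0 : 0 <= t by rewrite divr_ge0 ?ln_ge0 // ltW.
have Bt : B `^ t = l%:R^-1.
  rewrite /powR gt_eqF // /t invrN mulrN mulNr divfK ?expRN ?lnK // ?posrE ?ltr0n //.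
  by rewrite -oppr_eq0 gt_eqF.
have cont i : continuous (fun s : R => c i `^ s).
  move=> s; rewrite /powR gt_eqF //.
  apply: (@continuous_comp _ _ _ (fun s : R => s * ln (c i)) expR).
    exact: mulrr_continuous.
  exact: continuous_expR.
have [||s s0 fs] := @IVT R (fun s => \sum_i c i `^ s) 0 t 1 t0.
- apply: continuous_subspaceT; apply: continuous_big => //.
  exact: add_continuous.
- rewrite ge_min le_max; apply/andP; split; apply/orP; [right | left].
    apply: (@le_trans _ _ (\sum_(i < l) l%:R^-1)).
      apply: ler_sum => i _; rewrite -Bt; have /andP[_ cB] := bcB i.
      by rewrite ge0_ler_powR // nnegrE ltW.
    by rewrite sumr_const card_ord -[leLHS]mulr_natr mulVf // gt_eqF // ltr0n.
  by under eq_bigr do rewrite powRr0; rewrite sumr_const card_ord.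
by exists s => //; move: s0; rewrite in_itv /= => /andP[].
Qed.

(** * Local scaling and box dimension *)

Lemma nbhdP {R : realType} {n : nat} (F : set 'rV[R]_n) (delta : R) y :
  nbhd F delta y <-> exists2 k, F k & l2dist y k < delta.
Proof.
split=> [/ereal_inf_lt[_ [k Fk <-]]|[k Fk yk]].
  by rewrite lte_fin => yk; exists k.
apply: (@le_lt_trans _ _ (l2dist y k)%:E); last by rewrite lte_fin.
by apply: ereal_inf_lbound; exists k.
Qed.

Lemma balls_le_hausdorff_seq {R : realType} {n : nat} (n_gt0 : (0 < n)%N)
    (T : eqType) (s : seq T) (z : T -> 'rV[R]_n) (rho : R) (A : set 'rV[R]_n) :
  0 < rho -> uniq s ->
  {in s &, forall u v, u != v -> 2 * rho <= l2dist (z u) (z v)} ->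
  (forall u y, u \in s -> l2dist y (z u) < rho -> A y) ->
  (((size s)%:R * (rho / (4 * n%:R)) ^+ n)%:E <= hausdorff A)%E.
Proof.
move=> rho0 us sepz zA.
apply: (@balls_le_hausdorff _ _ n_gt0 (size s) (fun i => z (tnth (in_tuple s) i))) => //.
  move=> i j ij; apply: sepz; rewrite ?mem_tnth //.
  have x0 := tnth (in_tuple s) i.
  by rewrite (tnth_nth x0) (tnth_nth x0 _ j) nth_uniq.
by move=> i y; apply: zA; rewrite mem_tnth.
Qed.

(** * Volume estimates for neighbourhoods of the self-similar set *)

Section LocalScaling.
Context {R : realType} {n l : nat}.
Hypothesis n_gt0 : (0 < n)%N.
Variables (phi : 'I_l -> 'rV[R]_n -> 'rV[R]_n) (c : 'I_l -> R) (b B s : R).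
Variables (K O : set 'rV[R]_n) (o k0 : 'rV[R]_n) (a C : R).
Hypotheses (c_gt0 : forall i, 0 < c i) (phi_sim : forall i, similarity (c i) (phi i)).
Hypotheses (b_gt0 : 0 < b) (b_le1 : b <= 1) (B_gt0 : 0 < B) (B_lt1 : B < 1).
Hypothesis c_bounds : forall i, b <= c i <= B.
Hypotheses (s_ge0 : 0 <= s) (sum_c : \sum_i c i `^ s = 1).
Hypothesis K_inv : K = \bigcup_(i in [set: 'I_l]) (phi i @` K).
Hypothesis O_inv : forall i, phi i @` O `<=` O.
Hypothesis O_disj : forall i j, i != j -> phi i @` O `&` phi j @` O = set0.
Hypotheses (a_gt0 : 0 < a) (a_le1 : a <= 1) (oO : l2ball o a `<=` O).
Hypotheses (C_gt0 : 0 < C) (KC : forall k, K k -> l2dist k o <= C) (Kk0 : K k0).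

(** Everything the estimates use about a cut, with the fuel hidden. *)
Definition cut_spec (rho : R) (W : seq (seq 'I_l)) :=
  [/\ uniq W,
      forall x, K x -> exists2 w, w \in W & exists2 y, K y & x = word_map phi w y,
      {in W &, forall u v, u != v ->
        a * word_ratio c u <= l2dist (word_map phi u o) (word_map phi v o)},
      {in W, forall w, b * rho <= word_ratio c w <= rho} &
      \sum_(w <- W) word_ratio c w `^ s = 1].

Lemma cut_exists rho : 0 < rho -> rho <= 1 -> exists W, cut_spec rho W.
Proof.
move=> rho0 rho1.
have [m Bm] : exists m, B ^+ m <= rho.
  have /cvgr_le/(_ _ rho0)[m _ /(_ m (leqnn m)) Bm] :
      (B ^+ m @[m --> \oo] --> 0).
    by apply: cvg_expr; rewrite ger0_norm // ltW.
  by exists m.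
exists (cut c m rho); split.
- exact: uniq_cut.
- by move=> x; exact: cut_cover.
- by move=> u v uW vW; exact: (cut_separated c_gt0 phi_sim O_inv O_disj oO a_gt0 uW vW).
- move=> w wW; rewrite (cut_ratio_ge _ _ _ _ _ wW) //=; last first.
    by move=> i; have /andP[] := c_bounds i.
  by apply: (cut_ratio_le _ _ _ Bm wW) => // i; have /andP[] := c_bounds i.
- exact: sum_cut.
Qed.

(** The [s]-th powers of the ratios sum to 1 and each is at least [(b * rho) ^ s]; the opposite
    bound below uses that each is at most [rho ^ s]. *)
Lemma size_cut_le rho W : 0 < rho -> cut_spec rho W ->
  (size W)%:R * rho `^ s <= (b `^ s)^-1.
Proof.
move=> rho0 [_ _ _ Wr Ws].
rewrite -[leRHS]mul1r ler_pdivlMr ?powR_gt0 // -mulrA.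
rewrite -powRM ?(ltW rho0) ?(ltW b_gt0) // -[leRHS]Ws.
rewrite -sum1_size natr_sum mulr_suml big_seq [leRHS]big_seq.
apply: ler_sum => w /Wr/andP[bw _]; rewrite mul1r mulrC.
by rewrite ge0_ler_powR // nnegrE ?mulr_ge0 ?ltW // word_ratio_gt0.
Qed.

Lemma size_cut_ge rho W : 0 < rho -> cut_spec rho W ->
  1 <= (size W)%:R * rho `^ s.
Proof.
move=> rho0 [_ _ _ Wr Ws]; rewrite -[leLHS]Ws.
rewrite -sum1_size natr_sum mulr_suml big_seq [leRHS]big_seq.
apply: ler_sum => w /Wr/andP[_ bw]; rewrite mul1r.
by rewrite ge0_ler_powR // nnegrE ltW // word_ratio_gt0.
Qed.

(** The first factor cancels the number of pieces, about [(delta / r) ^ - s]; what remains is the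
    local scaling expression. *)
Lemma exprn_powR_split (delta r : R) : 0 < delta -> 0 < r ->
  delta ^+ n = (delta / r) `^ s * (delta `^ (n%:R - s) * r `^ s).
Proof.
move=> d0 r0; have d_neq0 : delta != 0 by rewrite gt_eqF.
have r_neq0 : r != 0 by rewrite gt_eqF.
rewrite mulrCA -powRM ?divr_ge0 ?(ltW d0) ?(ltW r0) // divfK //.
by rewrite -powRD ?d_neq0 ?implybT // subrK powR_mulrn // ltW.
Qed.

(** The points are [a * b * rho] apart, so balls of radius [t * rho] around them form a packing
    inside one ball of radius [(2 + C + t) * rho]. Comparing Hausdorff measures, [rho] cancels and
    [q] is uniform. *)
Lemma crowd_bound : exists2 q : R, 0 <= q &
  forall rho W F x, 0 < rho -> cut_spec rho W -> uniq F -> {subset F <= W} ->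
  {in F, forall w, l2dist (word_map phi w o) x <= (2 + C) * rho} ->
  (size F)%:R <= q.
Proof.
pose t := a * b / 2.
have t0 : 0 < t by rewrite divr_gt0 ?mulr_gt0.
have nR0 : 0 < n%:R :> R by rewrite ltr0n.
have tn0 : 0 < t / (4 * n%:R) by rewrite divr_gt0 ?mulr_gt0.
have Ct0 : 0 < 2 + C + t by rewrite !addr_gt0.
exists ((2 * n%:R * (2 + C + t) / (t / (4 * n%:R))) ^+ n).
  by rewrite exprn_ge0 // ltW // divr_gt0 // !mulr_gt0.
move=> rho W F x rho0 [_ _ Wsep Wr _] uF FW Fx.
have H : (size F)%:R * (t * rho / (4 * n%:R)) ^+ n <=
    (2 * n%:R * ((2 + C + t) * rho)) ^+ n; last first.
  rewrite expr_div_n ler_pdivlMr ?exprn_gt0 // -(ler_pM2r (exprn_gt0 n rho0)).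
  rewrite -[leLHS]mulrA -!exprMn (mulrAC t) -[X in _ <= X ^+ _]mulrA.
  exact: H.
rewrite -lee_fin -[X in (_ <= X%:E)%E]mul1r.
apply: le_trans (hausdorff_le_balls n_gt0 (s := [:: x])
  (A := l2ball x ((2 + C + t) * rho)) (mulr_gt0 Ct0 rho0) _); last first.
  by move=> y; rewrite /l2ball /= => xy; exists x; rewrite ?inE // l2distC.
apply: (balls_le_hausdorff_seq n_gt0 (z := fun w => word_map phi w o)
  (mulr_gt0 t0 rho0) uF).
- move=> u v uF' vF' uv; apply: le_trans (Wsep _ _ (FW _ uF') (FW _ vF') uv).
  have /andP[bu _] := Wr _ (FW _ uF').
  have := ler_wpM2l (ltW a_gt0) bu; rewrite /t; lra.
- move=> w y wF yw; rewrite /l2ball /= l2distC.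
  apply: le_lt_trans (l2dist_triangle y (word_map phi w o) x) _.
  have := Fx w wF; lra.
Qed.

Lemma local_upper : exists2 c4, 0 < c4 & forall r delta x,
  0 < r -> r <= 1 -> 0 < delta -> delta < r ->
  (hausdorff (l2ball x r `&` nbhd K delta) <=
   (c4 * (delta `^ (n%:R - s) * r `^ s))%:E)%E.
Proof.
have [q q0 qP] := crowd_bound.
have nR0 : 0 < n%:R :> R by rewrite ltr0n.
have C1 : 0 < 1 + C by rewrite addr_gt0.
(* [q + 1] keeps the constant positive when [q] is 0. *)
exists ((q + 1) * (2 * n%:R * (1 + C)) ^+ n * (b `^ s)^-1).
  by rewrite !mulr_gt0 ?invr_gt0 ?powR_gt0 ?exprn_gt0 ?mulr_gt0 // ltr_wpDl.
move=> r delta x r0 r1 d0 dr.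
have dr0 : 0 < delta / r by rewrite divr_gt0.
have dr1 : delta / r <= 1 by rewrite ler_pdivrMr // mul1r ltW.
(* Cutting at scale [r] and then at relative scale [delta / r] yields pieces of ratio at most
   [delta]. *)
have [W Wspec] := cut_exists r0 r1.
have [V Vspec] := cut_exists dr0 dr1.
have [Wuniq Wcov Wsep Wr Wsum] := Wspec.
have [_ Vcov _ Vr _] := Vspec.
pose F := [seq u <- W | `[< l2dist (word_map phi u o) x <= (2 + C) * r >]].
have Fq : (size F)%:R <= q.
  apply: (qP r W F x) => //; first exact: filter_uniq.
    by move=> u; rewrite mem_filter => /andP[].
  by move=> u; rewrite mem_filter => /andP[/asboolP].
have Vs := size_cut_le dr0 Vspec.
pose Z := [seq word_map phi u (word_map phi v o) | u <- F, v <- V].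
have dC0 : 0 < (1 + C) * delta by rewrite mulr_gt0.
apply: le_trans (hausdorff_le_balls n_gt0 (s := Z) dC0 _) _ => [y|].
  move=> [xy /nbhdP[k Kk yk]].
  have [u uW [k1 Kk1 ku]] := Wcov k Kk.
  have [v vV [k2 Kk2 kv]] := Vcov k1 Kk1.
  have /andP[_ ur] := Wr u uW; have /andP[_ vr] := Vr v vV.
  have u0 := word_ratio_gt0 c_gt0 u; have v0 := word_ratio_gt0 c_gt0 v.
  (* The centre of the piece is within [C * r] of [k], which is within [delta < r] of [y], itself
     within [r] of [x]. *)
  have uF : u \in F.
    rewrite mem_filter uW andbT; apply/asboolP.
    have d1 : l2dist (word_map phi u o) k <= r * C.
      rewrite ku (word_map_similarity phi_sim) l2distC.
      by rewrite ler_pM ?l2dist_ge0 ?(ltW u0) ?KC.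
    have := l2dist_triangle (word_map phi u o) k x.
    have := l2dist_triangle k y x; rewrite (l2distC k y) (l2distC y x).
    move: xy; rewrite /l2ball /=; lra.
  exists (word_map phi u (word_map phi v o)).
    by apply/allpairsP; exists (u, v).
  apply: le_lt_trans (l2dist_triangle y k _) _.
  have : l2dist k (word_map phi u (word_map phi v o)) <= r * (delta / r * C).
    rewrite ku kv !(word_map_similarity phi_sim).
    by rewrite !ler_pM ?mulr_ge0 ?l2dist_ge0 ?(ltW u0) ?(ltW v0) ?KC.
  rewrite mulrA mulrCA divff ?gt_eqF // mulr1; lra.
rewrite lee_fin size_allpairs natrM [_ * ((1 + C) * delta)]mulrA exprMn.
rewrite (exprn_powR_split d0 r0).
set X := _ `^ _ * r `^ s; set M := (2 * n%:R * (1 + C)) ^+ n.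
have X0 : 0 <= X by rewrite mulr_ge0 ?powR_ge0.
have M0 : 0 <= M by rewrite exprn_ge0 // !mulr_ge0 // ltW.
rewrite (_ : _ * _ = (size F)%:R * ((size V)%:R * (delta / r) `^ s) * (M * X)); last by ring.
rewrite [leRHS](_ : _ = (q + 1) * (b `^ s)^-1 * (M * X)); last by ring.
apply: ler_wpM2r; first by rewrite mulr_ge0.
apply: ler_pM => //; first by rewrite mulr_ge0 ?powR_ge0.
by rewrite (le_trans Fq) // lerDl.
Qed.

(** Serves the box dimension, which concerns the whole neighbourhood; a single cut at scale [delta]
    suffices. *)
Lemma global_upper : exists2 c4, 0 < c4 & forall delta,
  0 < delta -> delta <= 1 ->
  (hausdorff (nbhd K delta) <= (c4 * delta `^ (n%:R - s))%:E)%E.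
Proof.
have nR0 : 0 < n%:R :> R by rewrite ltr0n.
have C1 : 0 < 1 + C by rewrite addr_gt0.
exists ((2 * n%:R * (1 + C)) ^+ n * (b `^ s)^-1).
  by rewrite !mulr_gt0 ?invr_gt0 ?powR_gt0 ?exprn_gt0 ?mulr_gt0.
move=> delta d0 d1.
have [V Vspec] := cut_exists d0 d1.
have [_ Vcov _ Vr _] := Vspec.
have Vs := size_cut_le d0 Vspec.
pose Z := [seq word_map phi v o | v <- V].
have dC0 : 0 < (1 + C) * delta by rewrite mulr_gt0.
apply: le_trans (hausdorff_le_balls n_gt0 (s := Z) dC0 _) _ => [y|].
  move=> /nbhdP[k Kk yk].
  have [v vV [k2 Kk2 kv]] := Vcov k Kk.
  have /andP[_ vr] := Vr v vV.
  have v0 := word_ratio_gt0 c_gt0 v.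
  exists (word_map phi v o); first exact: map_f.
  apply: le_lt_trans (l2dist_triangle y k _) _.
  have : l2dist k (word_map phi v o) <= delta * C.
    rewrite kv !(word_map_similarity phi_sim).
    by rewrite !ler_pM ?mulr_ge0 ?l2dist_ge0 ?(ltW v0) ?KC.
  lra.
rewrite lee_fin size_map [_ * ((1 + C) * delta)]mulrA exprMn.
rewrite (exprn_powR_split d0 ltr01) divr1 powR1 mulr1.
set X := delta `^ (n%:R - s); set M := (2 * n%:R * (1 + C)) ^+ n.
have X0 : 0 <= X by rewrite powR_ge0.
have M0 : 0 <= M by rewrite exprn_ge0 // !mulr_ge0 // ltW.
rewrite (_ : _ * _ = ((size V)%:R * delta `^ s) * (M * X)); last by ring.
rewrite [leRHS](_ : _ = (b `^ s)^-1 * (M * X)); last by ring.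
by rewrite ler_wpM2r ?mulr_ge0.
Qed.

(** The piece of scale [e * r] containing [x] fits well inside the ball. Its subpieces give
    separated images of [o]; as [o] may lie outside [K], the images of [k0] show that these points
    are close to [K]. *)
Lemma local_lower : exists2 c3, 0 < c3 & forall r delta x,
  0 < r -> r <= 1 -> 0 < delta -> delta < r -> K x ->
  ((c3 * (delta `^ (n%:R - s) * r `^ s))%:E <=
   hausdorff (l2ball x r `&` nbhd K delta))%E.
Proof.
have nR0 : 0 < n%:R :> R by rewrite ltr0n.
(* Small enough that [2 * e * C <= 1/4], which bounds the distances below by [delta / 4] and
   [r / 4]. *)
pose e := (12 * (1 + C))^-1.
have e0 : 0 < e by rewrite invr_gt0 mulr_gt0 // addr_gt0.
have e12 : e * (12 * (1 + C)) = 1 by rewrite mulVf // gt_eqF // mulr_gt0 // addr_gt0.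
have eC0 : 0 < e * C by rewrite mulr_gt0.
have e1 : e <= 1 by lra.
(* The ratio of [u] is at least [b * e * r] and the images of [o] under the words of [V] are
   [a * b * delta / r] apart, so the product is [2 * t * delta]. *)
pose t := a * b * b * e / 2.
have t0 : 0 < t by rewrite divr_gt0 // !mulr_gt0.
have t4 : t <= 1 / 4.
  have : a * b * b * e <= 1 * e.
    have ab1 : a * b <= 1 by rewrite mulr_ile1 ?(ltW a_gt0) ?(ltW b_gt0).
    by rewrite ler_wpM2r ?(ltW e0) // mulr_ile1 ?mulr_ge0 ?(ltW a_gt0) ?(ltW b_gt0).
  rewrite /t; lra.
exists ((t / (4 * n%:R)) ^+ n).
  by rewrite exprn_gt0 // divr_gt0 ?mulr_gt0.
move=> r delta x r0 r1 d0 dr Kx.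
have dr0 : 0 < delta / r by rewrite divr_gt0.
have dr1 : delta / r <= 1 by rewrite ler_pdivrMr // mul1r ltW.
have er0 : 0 < e * r by rewrite mulr_gt0.
have er1 : e * r <= 1 by rewrite mulr_ile1 ?(ltW e0) ?(ltW r0).
have [W [_ Wcov _ Wr _]] := cut_exists er0 er1.
have [V Vspec] := cut_exists dr0 dr1.
have [Vuniq Vcov Vsep Vr _] := Vspec.
have Vs := size_cut_ge dr0 Vspec.
have [u uW [k1 Kk1 xu]] := Wcov x Kx.
have /andP[ub ur] := Wr u uW; have u0 := word_ratio_gt0 c_gt0 u.
have td0 : 0 < t * delta by rewrite mulr_gt0.
apply: le_trans (balls_le_hausdorff_seq n_gt0 (s := V)
  (z := fun v => word_map phi u (word_map phi v o)) td0 Vuniq _ _).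
- rewrite lee_fin (_ : t * delta / _ = t / (4 * n%:R) * delta); last by rewrite mulrAC.
  rewrite [in leRHS]exprMn (exprn_powR_split d0 r0).
  set X := _ `^ _ * r `^ s; set M := (t / _) ^+ n.
  have X0 : 0 <= X by rewrite mulr_ge0 ?powR_ge0.
  have M0 : 0 <= M by rewrite exprn_ge0 // ltW // divr_gt0 // mulr_gt0.
  rewrite [leRHS](_ : _ = ((size V)%:R * (delta / r) `^ s) * (M * X)); last by ring.
  by rewrite ler_peMl // mulr_ge0.
- move=> v w vV wV vw; rewrite (word_map_similarity phi_sim).
  have /andP[vb _] := Vr v vV.
  have h1 := Vsep _ _ vV wV vw.
  have h2 : a * (b * (delta / r)) <= l2dist (word_map phi v o) (word_map phi w o).
    by apply: le_trans h1; rewrite ler_wpM2l // ltW.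
  have p1 : 0 <= b * (e * r) by rewrite ltW // mulr_gt0.
  have p2 : 0 <= a * (b * (delta / r)) by rewrite ltW // !mulr_gt0 ?invr_gt0.
  apply: le_trans (ler_pM p1 p2 ub h2).
  have -> : b * (e * r) * (a * (b * (delta / r))) =
      a * b * b * e * delta * (r / r) by ring.
  rewrite divff ?gt_eqF // mulr1 /t; lra.
- move=> v y vV yz.
  have /andP[_ vr] := Vr v vV; have v0 := word_ratio_gt0 c_gt0 v.
  pose k := word_map phi u (word_map phi v k0).
  have Kk : K k by do 2!apply: (word_map_inv K_inv).
  have zk : l2dist (word_map phi u (word_map phi v o)) k <= e * r * (delta / r * C).
    rewrite /k !(word_map_similarity phi_sim) (l2distC o).
    by rewrite !ler_pM ?mulr_ge0 ?l2dist_ge0 ?(ltW u0) ?(ltW v0) ?KC.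
  have kx : l2dist k x <= e * r * (C + C).
    rewrite xu (word_map_similarity phi_sim) ler_pM ?l2dist_ge0 ?(ltW u0) //.
    apply: le_trans (l2dist_triangle _ o _) _; apply: lerD.
      by apply: KC; exact: (word_map_inv K_inv).
    by rewrite l2distC KC.
  have zk4 : l2dist (word_map phi u (word_map phi v o)) k <= delta / 4.
    apply: le_trans zk _.
    rewrite (_ : _ * _ = e * C * delta * (r / r)); last by ring.
    rewrite divff ?gt_eqF // mulr1.
    have : e * C * delta <= 1 / 4 * delta by rewrite ler_wpM2r ?(ltW d0) //; lra.
    lra.
  have kx4 : l2dist k x <= r / 4.
    apply: le_trans kx _.
    have : e * (C + C) * r <= 1 / 4 * r by rewrite ler_wpM2r ?(ltW r0) //; lra.
    lra.
  have td4 : t * delta <= 1 / 4 * delta by rewrite ler_wpM2r ?(ltW d0).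
  have yk : l2dist y k < delta.
    apply: le_lt_trans (l2dist_triangle _ (word_map phi u (word_map phi v o)) _) _.
    lra.
  split; last by apply/nbhdP; exists k.
  rewrite /l2ball /= l2distC; apply: le_lt_trans (l2dist_triangle _ k _) _.
  have : l2dist y k <= delta / 2.
    apply: le_trans (l2dist_triangle _ (word_map phi u (word_map phi v o)) _) _.
    lra.
  lra.
Qed.

End LocalScaling.

(** After taking logarithms, [ln f] differs from [(n - s) * ln delta] by a bounded amount, and
    [ln delta] tends to minus infinity. *)
Lemma powR_sandwich_dimension {R : realType} (n : nat) (f : R -> \bar R) (s A B : R) :
  0 < A -> 0 < B ->
  (forall delta, 0 < delta -> delta < 1 / 2 ->
    ((A * delta `^ (n%:R - s))%:E <= f delta <= (B * delta `^ (n%:R - s))%:E)%E) ->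
  n%:R - lim (ln (fine (f delta)) / ln delta @[delta --> 0^'+]) = s.
Proof.
move=> A0 B0 fAB.
suff -> : lim (ln (fine (f delta)) / ln delta @[delta --> 0^'+]) = n%:R - s.
  by rewrite opprB addrC subrK.
apply: cvg_lim => //; apply/cvgrPdist_le => e e0.
pose L := Num.max `|ln A| `|ln B|.
near=> delta.
have d0 : 0 < delta by near: delta; exact: nbhs_right_gt.
have d2 : delta < 1 / 2 by near: delta; apply: nbhs_right_lt; rewrite divr_gt0.
have lnd : ln delta <= - (L / e).
  by near: delta; have /cvgrNy_le/(_ (- (L / e))) := @lnNy R; apply.
have lnd0 : ln delta < 0 by rewrite ln_lt0 // d0 /=; lra.
have p0 : 0 < delta `^ (n%:R - s) by rewrite powR_gt0.
have := fAB delta d0 d2.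
case: (f delta) => [v| |] /=; rewrite ?leNye ?leey ?andbF //.
rewrite !lee_fin => /andP[Av vB].
have v0 : 0 < v by rewrite (lt_le_trans _ Av) // mulr_gt0.
have : ln A + (n%:R - s) * ln delta <= ln v.
  by rewrite -ln_powR -lnM ?posrE // ler_ln ?posrE ?mulr_gt0.
have : ln v <= ln B + (n%:R - s) * ln delta.
  by rewrite -ln_powR -lnM ?posrE // ler_ln ?posrE ?mulr_gt0.
move=> vB' vA'.
have /andP[A1 A2] : - L <= ln A <= L by rewrite -ler_norml le_max lexx.
have /andP[B1 B2] : - L <= ln B <= L by rewrite -ler_norml le_max lexx orbT.
rewrite -(ler_pM2r (_ : 0 < `|ln delta|)) ?normr_gt0 ?lt_eqF //.
rewrite -normrM mulrBl divfK ?lt_eqF // (ltr0_norm lnd0).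
have : L <= e * - ln delta by rewrite mulrC -ler_pdivrMr // lerNr.
by move=> Le; rewrite ler_norml; apply/andP; split; lra.
Unshelve. all: by end_near. Qed.

Lemma l2ball_sub_open {R : realType} {n : nat} (O : set 'rV[R]_n) o :
  open O -> O o -> exists a, [/\ 0 < a, a <= 1 & l2ball o a `<=` O].
Proof.
move=> Oo Ox; have /nbhs_ballP[a /= a0 aO] := open_nbhs_nbhs (conj Oo Ox).
(* Capping the radius at 1 provides the bound [a <= 1] used for [t <= 1 / 4] in [local_lower]. *)
exists (Num.min a 1); split; rewrite ?lt_min ?ge_min ?a0 ?lexx ?orbT ?ltr01 //.
move=> y; rewrite /l2ball /= lt_min => /andP[oy _]; apply: aO.
split=> // i j; rewrite ord1 /ball /=.
exact: le_lt_trans (coord_le_l2dist _ _ _) oy.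
Qed.

Lemma compact_l2dist_bounded {R : realType} {n : nat} (K : set 'rV[R]_n) o :
  compact K -> exists2 C, 0 < C & forall k, K k -> l2dist k o <= C.
Proof.
move=> /compact_bounded[M [_ /(_ (`|M| + 1))MK]].
have M0 : 0 <= `|M| + 1 by rewrite addr_ge0.
exists (1 + n%:R * (`|M| + 1) + l2dist 0 o) => [|k Kk].
  by rewrite -addrA ltr_pwDl // addr_ge0 ?l2dist_ge0 // mulr_ge0.
have kM : `|k| <= `|M| + 1.
  by apply: MK => //; rewrite (le_lt_trans (ler_norm M)) // ltrDl.
apply: le_trans (l2dist_triangle _ 0 _) _; rewrite lerD2r.
apply: (@le_trans _ _ (n%:R * (`|M| + 1))); last by rewrite lerDr.
apply: l2dist_le_coord => // i; rewrite mxE subr0.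
apply: le_trans kM; rewrite [leRHS]mx_normrE.
exact: (le_bigmax _ (fun ij => `|k ij.1 ij.2|) (ord0, i)).
Qed.

Theorem mainTheorem4 (R : realType) (n l : nat)
    (phi : 'I_l -> 'rV[R]_n -> 'rV[R]_n) (K : set 'rV[R]_n)
    (n_gt0 : (0 < n)%N)
    (phi_sim : forall i, contracting_similarity (phi i))
    (phi_osc : open_set_condition phi)
    (K_neq0 : K !=set0)
    (K_compact : compact K)
    (K_inv : K = \bigcup_(i in [set: 'I_l]) (phi i @` K)) :
  local_scaling K (box_dim K / n%:R).
Proof.
have [c cP] := choice phi_sim.
have c0 i : 0 < c i by have [] := cP i.
have c1 i : c i < 1 by have [] := cP i.
have phic i : similarity (c i) (phi i) by have [] := cP i.
have [k0 Kk0] := K_neq0.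
have l0 : (0 < l)%N.
  by move: Kk0; rewrite {1}K_inv => -[i _ _]; exact: leq_ltn_trans (ltn_ord i).
have [s s0 cs] := similarity_dimension l0 c0 c1.
have [b [B [[b0 b1 B0 B1] bcB]]] := finite_uniform_bounds c0 c1.
have [G [Gopen [p Gp] Ginv Gdisj]] := phi_osc.
have [a [a0 a1 aO]] := l2ball_sub_open Gopen Gp.
have [C C0 KC] := compact_l2dist_bounded p K_compact.
have [c3 c30 low] := local_lower n_gt0 c0 phic b0 b1 B0 B1 bcB s0 cs K_inv Ginv
  Gdisj a0 a1 aO C0 KC Kk0.
have [c4 c40 up] := local_upper n_gt0 c0 phic b0 b1 B0 B1 bcB s0 cs K_inv Ginv
  Gdisj a0 aO C0 KC.
have [c5 c50 gup] := global_upper n_gt0 c0 phic b0 b1 B0 B1 bcB s0 cs K_inv Ginv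
  Gdisj a0 aO C0 KC.
(* The lower bound is the local one at the fixed radius 1/2, whence the factor [(1 / 2) ^ s] and the
   range [delta < 1 / 2]. *)
have dimK : box_dim K = s.
  apply: (@powR_sandwich_dimension _ _ _ _ (c3 * (1 / 2) `^ s) c5) => // [|d d0 d2].
    by rewrite mulr_gt0 // powR_gt0 // divr_gt0.
  rewrite gup ?andbT //; last by lra.
  have half0 : 0 < 1 / 2 :> R by lra.
  have half1 : 1 / 2 <= 1 :> R by lra.
  apply: (@le_trans _ _ (hausdorff (l2ball k0 (1 / 2) `&` nbhd K d))).
    by rewrite mulrAC -mulrA; exact: low.
  by apply: le_hausdorff => y [].
have nR0 : n%:R != 0 :> R by rewrite pnatr_eq0 -lt0n.
(* The threshold is 1 because cuts are taken at scales at most 1. *)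
exists c3, c4, 1; split=> // r d x r0 r1 d0 dr Kx.
by rewrite dimK divfK // -!mulrA low ?up // ltW.
Qed.
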